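(* Let $\boldsymbol{\pi}\in\mathbb{R}^n$ be a vector with positive entries such that $\boldsymbol{\pi}^T\mathbf{1}=1$, and let $\mathbb{S}_n^{\boldsymbol{\pi}} = \{ S \in \mathbb{R}^{n \times n} : S \mathbf{1} = \mathbf{1},\ \boldsymbol{\pi}^T S = \boldsymbol{\pi}^T,\ S > 0 \}$. Then the tangent space to $\mathbb{S}_n^{\boldsymbol{\pi}}$ at $S\in\mathbb{S}_n^{\boldsymbol{\pi}}$ is given by $$\mathcal{T}_S \mathbb{S}_n^{\boldsymbol{\pi}} = \{ \xi_S \in \mathbb{R}^{n \times n} : \xi_S \mathbf{1} = \mathbf{0},\ \boldsymbol{\pi}^T \xi_S = \mathbf{0}^T \}.$$
   Context: $\mathbf{1}=(1,\ldots,1)^T\in\mathbb{R}^n$, and $S>0$ means that all entries of $S$ are positive. The set $\mathbb{S}_n^{\boldsymbol{\pi}}$ is regarded as a smooth embedded submanifold of $\mathbb{R}^{n\times n}$ (of dimension $(n-1)^2$). The tangent space $\mathcal{T}_S\mathbb{S}_n^{\boldsymbol{\pi}}$ is the set of all velocities $\dot\gamma(0)$ of smooth curves $\gamma$ defined on a neighborhood of $0\in\mathbb{R}$, with values in $\mathbb{S}_n^{\boldsymbol{\pi}}$ and $\gamma(0)=S$, identified with a subspace of $\mathbb{R}^{n\times n}$. *)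

(* Defs.v *)
From HB Require Import structures.
From mathcomp Require Import all_boot all_order all_algebra.
From mathcomp Require Import boolp classical_sets reals topology normedtype derive.

Set Implicit Arguments.
Unset Strict Implicit.
Unset Printing Implicit Defensive.

Import Order.TTheory GRing.Theory Num.Theory.
Import numFieldNormedType.Exports.

Local Open Scope classical_set_scope.
Local Open Scope ring_scope.

Definition ones (R : realType) (n : nat) : 'cV[R]_n := const_mx 1.

(* Row-stochastic positive matrices with left Perron vector mu (which
   is usually written as a bold pi; the name [pi] is taken by the real
   number). *)
Definition multinomial_manifold (R : realType) (n : nat) (mu : 'cV[R]_n) :
    set 'M[R]_n :=
  [set S | [/\ S *m ones R n = ones R n,
               mu^T *m S = mu^T
             & forall i j, 0 < S i j]].

(* C^infinity on U; to be used with U open, so that the iterated derivatives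
   on U depend only on the restriction of g to U. *)
Definition smooth_on (R : realType) (V : normedModType R) (U : set R)
    (g : R -> V) : Prop :=
  forall (k : nat) (t : R), U t -> derivable g^`(k)%classic t 1.

(* Velocities at 0 of smooth curves in M through x.  A curve defined on a
   neighbourhood U of 0 is represented by a total function whose values
   outside U are irrelevant.  For M an embedded submanifold of V,
   smoothness of a curve into M is smoothness as a curve into V. *)
Definition tangent_space (R : realType) (V : normedModType R) (M : set V)
    (x : V) : set V :=
  [set v | exists (U : set R) (g : R -> V),
      [/\ open U, U 0, smooth_on U g, (forall t, U t -> M (g t))
        & g 0 = x /\ g^`()%classic 0 = v]].

(* Main.v *)
Require Import Defs.
From HB Require Import structures.
From mathcomp Require Import all_boot all_order all_algebra.
From mathcomp Require Import boolp classical_sets reals topology normedtype derive.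

Set Implicit Arguments.
Unset Strict Implicit.
Unset Printing Implicit Defensive.

Import Order.TTheory GRing.Theory Num.Theory.
Import numFieldNormedType.Exports.

Local Open Scope classical_set_scope.
Local Open Scope ring_scope.

(** The manifold is the intersection of the affine space cut out by the two
    linear constraints [S *m ones = ones] and [mu^T *m S = mu^T] with the open
    set of entrywise positive matrices, so its tangent space is the direction
    of that affine space.

    Velocities satisfy the homogeneous constraints: along a curve in the
    manifold each linear constraint map is constant, so the difference
    quotients lie in its kernel, which is closed because linear maps between
    matrix spaces are continuous; hence so does their limit
    ([derive1_linear_mx_eq0]).

    Conversely, if [xi] satisfies the homogeneous constraints, the line
    [t |-> S + t *: xi] satisfies the affine ones for every [t] and has
    positive entries for [t] in an open neighbourhood of [0], namely the
    preimage of an open set ([open_mx_gt0]); it is smooth with velocity [xi]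
    ([smooth_on_affine], [derive1_affine]). *)

(** A derivative is a limit of rescaled increments, so it stays in any closed
    set stable under scaling that contains the increments near the point. *)
Lemma derive1_in_closed (R : realType) (V : normedModType R) (K : set V)
    (g : R -> V) (t : R) :
  closed K -> (forall (a : R) v, K v -> K (a *: v)) ->
  derivable g t 1 -> (\forall s \near t, K (g s - g t)) ->
  K (g^`()%classic t).
Proof.
move=> Kcl Kscale dg Kg; rewrite derive1E.
apply: (closed_cvg _ Kcl) dg => //.
have Kh : \forall h \near (0 : R), K (g (h + t) - g t).
  by move: Kg; rewrite (near_shift 0) subr0.
apply: (@filterS _ _ _ [set h | K (g (h + t) - g t)]); last exact: nbhs_dnbhs.
by move=> h Kgh; apply: Kscale; rewrite /= [h%:A]mulr1.
Qed.

(** An entry of [f A] is a fixed linear combination of the entries of [A],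
    hence continuous in [A]. *)
Lemma closed_ker_mx (R : realType) (m n p q : nat)
    (f : {linear 'M[R]_(m, n) -> 'M[R]_(p, q)}) :
  closed [set A | f A = 0].
Proof.
have -> : [set A | f A = 0] = \bigcap_i [set A | f A i.1 i.2 = 0].
  apply/seteqP; split => [A /= fA0 i _ /=|A fA0 /=]; first by rewrite fA0 mxE.
  by apply/matrixP => i j; rewrite mxE; apply: (fA0 (i, j)).
apply: closed_bigI => -[i j] _ /=.
apply: (@closed_comp _ _ (fun A => f A i j) [set 0]); last exact: closed_eq.
move=> A _.
have -> : (fun A => f A i j) =
    (fun A : 'M_(m, n) => \sum_k \sum_l A k l * f (delta_mx k l) i j).
  apply/funext => B; rewrite {1}[B]matrix_sum_delta !linear_sum summxE.
  apply: eq_bigr => k _; rewrite linear_sum summxE.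
  by apply: eq_bigr => l _; rewrite linearZ mxE.
have FA := nbhs_filter A.
apply: (cvg_big (F := nbhs A) add_continuous) => k _.
apply: (cvg_big (F := nbhs A) add_continuous) => l _.
by apply: (cvgMr_tmp (F := nbhs A)); apply: coord_continuous.
Qed.

(** If a linear map is constant along a curve near [t], it kills the velocity
    of the curve at [t]. *)
Lemma derive1_linear_mx_eq0 (R : realType) (m n p q : nat)
    (f : {linear 'M[R]_(m, n) -> 'M[R]_(p, q)}) (g : R -> 'M[R]_(m, n))
    (t : R) :
  derivable g t 1 -> (\forall s \near t, f (g s) = f (g t)) ->
  f (g^`()%classic t) = 0.
Proof.
move=> dg fg.
apply: (@derive1_in_closed _ _ [set A | f A = 0] _ _ _ _ dg).
- exact: closed_ker_mx.
- by move=> a A /= fA0; rewrite linearZ /= fA0 scaler0.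
- by apply: filterS fg => s /= fgs; rewrite linearB fgs subrr.
Qed.

Lemma open_mx_gt0 (R : realType) (m n : nat) :
  open [set A : 'M[R]_(m, n) | forall i j, 0 < A i j].
Proof.
rewrite openE => A /= A0; have FA := nbhs_filter A.
apply: (filter_forall (F := nbhs A)) => i.
apply: (filter_forall (F := nbhs A)) => j.
have gt0 : nbhs (A i j) [set x : R | 0 < x].
  by apply: open_nbhs_nbhs; split; [exact: open_gt | exact: A0].
exact: (coord_continuous gt0).
Qed.

Lemma is_derive_affine (R : realType) (V : normedModType R) (x v : V) (t : R) :
  is_derive t 1 (fun s : R => x + s *: v) v.
Proof.
have quot_cvg :
    h^-1 *: (((fun s : R => x + s *: v) \o shift t) (h *: 1) - (x + t *: v))
      @[h --> 0^'] --> v.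
  apply: cvg_near_cst; near=> h.
  have h0 : h != 0 by near: h; exact: nbhs_dnbhs_neq.
  rewrite /= [h%:A]mulr1 opprD addrACA subrr add0r -scalerBl addrK.
  by rewrite scalerA mulVf// scale1r.
apply: DeriveDef; first by apply/cvg_ex; exists v.
exact: (cvg_lim (@norm_hausdorff _ _) quot_cvg).
Unshelve. all: by end_near.
Qed.

Lemma derivable_affine (R : realType) (V : normedModType R) (x v : V) (t : R) :
  derivable (fun s : R => x + s *: v) t 1.
Proof. by have [] := is_derive_affine x v t. Qed.

Lemma derive1_affine (R : realType) (V : normedModType R) (x v : V) :
  (fun s : R => x + s *: v)^`()%classic = (fun=> v).
Proof.
by apply/funext => t; rewrite derive1E; have [_ ->] := is_derive_affine x v t.
Qed.

Lemma smooth_on_affine (R : realType) (V : normedModType R) (U : set R)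
    (x v : V) : smooth_on U (fun t : R => x + t *: v).
Proof.
case=> [|k] t _; first exact: derivable_affine.
suff [w ->] : exists w, (fun s : R => x + s *: v)^`(k.+1)%classic = (fun=> w).
  exact: derivable_cst.
elim: k => [|k [w IH]]; first by exists v; exact: derive1_affine.
by exists 0; rewrite derive1nS IH; apply/funext => s; rewrite derive1_cst.
Qed.

Theorem lemma4p1 (R : realType) (n : nat) (mu : 'cV[R]_n)
    (mu_gt0 : forall i, 0 < mu i 0)
    (mu_sum1 : mu^T *m ones R n = 1%:M)
    (S : 'M[R]_n) (S_in : multinomial_manifold mu S) :
  tangent_space (multinomial_manifold mu) S =
    [set xi : 'M[R]_n | xi *m ones R n = 0 /\ mu^T *m xi = 0].
Proof.
have [S1 muS S_gt0] := S_in.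
apply/seteqP; split=> [_ [U [g [Uop U0 gsm gM [g0 <-]]]]|xi /= [xi1 muxi]].
  have gU : \forall s \near (0 : R), U s by exact: open_nbhs_nbhs.
  have dg : derivable g 0 1 := gsm 0%N 0 U0.
  split.
    apply: (derive1_linear_mx_eq0 (f := mulmxr (ones R n)) dg).
    by apply: filterS gU => s /gM[gs1 _ _]; rewrite /= gs1 g0 S1.
  apply: (derive1_linear_mx_eq0 (f := mulmx mu^T) dg).
  by apply: filterS gU => s /gM[_ mugs _]; rewrite /= mugs g0 muS.
(* The curve realizing [xi] is the straight line; its domain is the set of
   times at which all entries remain positive. *)
pose g (t : R) := S + t *: xi.
exists (g @^-1` [set A | forall i j, 0 < A i j]), g; split.
- apply: open_comp (@open_mx_gt0 _ _ _) => t _.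
  apply: differentiable_continuous; apply/derivable1_diffP.
  exact: derivable_affine.
- by rewrite /= /g scale0r addr0.
- exact: smooth_on_affine.
- move=> t gt_gt0; split=> //.
    by rewrite mulmxDl S1 -scalemxAl xi1 scaler0 addr0.
  by rewrite mulmxDr muS -scalemxAr muxi scaler0 addr0.
- split; first by rewrite /g scale0r addr0.
  by rewrite derive1_affine.
Qed.
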